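(* There exists $\varepsilon>0$ with the following property. For every $n\ge 1$ and every $3$-dimensional linear subspace $L\subseteq\mathbb{R}^{2n}$, the unit sphere $S(L)=\{v\in L: |v|=1\}$ is not contained in the $\varepsilon$-neighborhood of any orbit $\mathbb{T}^n x\subset\mathbb{R}^{2n}$, $x\in\mathbb{R}^{2n}$. Consequently, for every $k\ge 3$ there do not exist a prime $p$, a $p$-torus $G$, an $n\ge k$, an orthogonal action of $G$ on $\mathbb{R}^n$ and a point $v\in\mathbb{S}^{n-1}$ such that the standardly embedded $\mathbb{S}^{k-1}\subset\mathbb{S}^{n-1}$ is contained in the $\varepsilon$-neighborhood of the orbit $Gv$.
   Context: Identify $\mathbb{R}^{2n}$ with $\mathbb{C}^n$; the torus $\mathbb{T}^n=\{(\zeta_1,\dots,\zeta_n)\in\mathbb{C}^n: |\zeta_i|=1\}$ acts by coordinatewise multiplication $(\zeta_i)\cdot(z_i)=(\zeta_i z_i)$. A $p$-torus is a group $G\cong(\mathbb{Z}_p)^\alpha$ acting on $\mathbb{R}^n$ by orthogonal linear maps (hence on $\mathbb{S}^{n-1}$, the unit sphere of $\mathbb{R}^n$). The $\varepsilon$-neighborhood is with respect to Euclidean distance; $\mathbb{S}^{k-1}\subset\mathbb{S}^{n-1}$ via $\mathbb{R}^k\subset\mathbb{R}^n$ as the first $k$ coordinates. *)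

(* Defs.v *)
From HB Require Import structures.
From mathcomp Require Import all_boot all_order all_algebra all_fingroup all_solvable.
From mathcomp Require Import mxrepresentation.
From mathcomp Require Import reals.
Set Implicit Arguments. Unset Strict Implicit. Unset Printing Implicit Defensive.
Import Order.TTheory GRing.Theory Num.Theory.
Local Open Scope ring_scope.

Definition enorm (R : realType) (m : nat) (v : 'rV[R]_m) : R :=
  Num.sqrt (\sum_(i < m) v 0 i ^+ 2).

Definition unit_sphere_of (R : realType) (r m : nat) (L : 'M[R]_(r, m)) :
    'rV[R]_m -> Prop :=
  fun v => (v <= L)%MS /\ enorm v = 1.

(* Identification R^{2n} = C^n: a vector x : 'rV_(n + n) corresponds to the
   point z with z_i = (lsubmx x) i + sqrt(-1) (rsubmx x) i.
   An element of the torus T^n is given by (c, s) with c_i^2 + s_i^2 = 1,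
   i.e. zeta_i = c_i + sqrt(-1) s_i.  The action is coordinatewise complex
   multiplication zeta_i * z_i. *)
Definition torus_elt (R : realType) (n : nat) (c s : 'rV[R]_n) : Prop :=
  forall i : 'I_n, c 0 i ^+ 2 + s 0 i ^+ 2 = 1.

Definition torus_act (R : realType) (n : nat) (c s : 'rV[R]_n)
    (x : 'rV[R]_(n + n)) : 'rV[R]_(n + n) :=
  row_mx (\row_i (c 0 i * lsubmx x 0 i - s 0 i * rsubmx x 0 i))
         (\row_i (s 0 i * lsubmx x 0 i + c 0 i * rsubmx x 0 i)).

Definition torus_orbit (R : realType) (n : nat) (x : 'rV[R]_(n + n)) :
    'rV[R]_(n + n) -> Prop :=
  fun y => exists c s : 'rV[R]_n, torus_elt c s /\ y = torus_act c s x.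

Definition eps_nbhd (R : realType) (m : nat) (eps : R) (A : 'rV[R]_m -> Prop) :
    'rV[R]_m -> Prop :=
  fun y => exists2 z, A z & enorm (y - z) < eps.

Definition subset_of (T : Type) (A B : T -> Prop) : Prop :=
  forall x, A x -> B x.

Definition std_sphere (R : realType) (m k : nat) : 'rV[R]_m -> Prop :=
  fun v => enorm v = 1 /\ forall i : 'I_m, (k <= i)%N -> v 0 i = 0.

Definition orthogonal_rep (R : realType) (gT : finGroupType) (G : {group gT})
    (m : nat) (rG : mx_representation R G m) : Prop :=
  forall g, g \in G -> rG g *m (rG g)^T = 1%:M.

Definition rep_orbit (R : realType) (gT : finGroupType) (G : {group gT})
    (m : nat) (rG : mx_representation R G m) (v : 'rV[R]_m) :
    'rV[R]_m -> Prop :=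
  fun y => exists2 g, g \in G & y = v *m rG g.

(* Main.v *)
(* The distance from y to the orbit T^n x in C^n is at least the l^2 distance
   between the vectors of moduli (|y_i|) and (|x_i|).  On a 3-dimensional real
   space L, each |y_i|^2 is a quadratic form of rank at most 2, hence degenerate,
   so it cannot be nearly constant on S(L): its square root deviates from any
   constant, over finitely many test points, by an amount proportional to its
   trace.  These traces add up to 3, which gives a uniform lower bound.
   For an abelian orthogonal group acting on R^m, unitary diagonalisation of the
   complexified action embeds R^m isometrically in C^m, carrying each orbit into
   a torus orbit. *)
Require Import Defs.
From HB Require Import structures.
From mathcomp Require Import all_boot all_order all_algebra all_fingroup all_solvable.
From mathcomp Require Import mxrepresentation.
From mathcomp Require Import reals.
From mathcomp Require Import complex mxred sesquilinear spectral ring lra.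
Import Order.TTheory GRing.Theory Num.Theory.
Local Open Scope ring_scope.

Set Implicit Arguments. Unset Strict Implicit. Unset Printing Implicit Defensive.

(** * Quadratic forms of rank at most 2 on 3-space and their square roots *)

(* A 3x3 matrix this close to a scalar one has positive determinant, whereas the
   Gram matrix of vectors (a_j, b_j) in the plane is singular. *)
Lemma degenerate_form_not_scalar (R : realFieldType) (a1 a2 a3 b1 b2 b3 c e : R) :
  let q11 := a1 ^+ 2 + b1 ^+ 2 in let q22 := a2 ^+ 2 + b2 ^+ 2 in
  let q33 := a3 ^+ 2 + b3 ^+ 2 in
  let q12 := a1 * a2 + b1 * b2 in let q13 := a1 * a3 + b1 * b3 in
  let q23 := a2 * a3 + b2 * b3 in
  0 < q11 + q22 + q33 -> 16 * e <= q11 + q22 + q33 ->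
  `|q11 - c| <= e -> `|q22 - c| <= e -> `|q33 - c| <= e ->
  `|q12| <= e -> `|q13| <= e -> `|q23| <= e -> False.
Proof.
move=> q11 q22 q33 q12 q13 q23 T0 eT.
rewrite !ler_norml => /andP[l1 u1] /andP[l2 u2] /andP[l3 u3].
move=> /andP[l12 u12] /andP[l13 u13] /andP[l23 u23].
(* This is the vanishing of the Gram determinant, the only trace of the rank bound used below. *)
have det0 : q11 * q22 * q33 + 2 * q12 * q13 * q23 =
  q11 * q23 ^+ 2 + q22 * q13 ^+ 2 + q33 * q12 ^+ 2.
  by rewrite /q11 /q22 /q33 /q12 /q13 /q23; ring.
clearbody q11 q22 q33 q12 q13 q23.
have e0 : 0 <= e by lra.
have sq x : - e <= x -> x <= e -> x ^+ 2 <= e ^+ 2.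
  by move=> lx ux; rewrite -real_normK ?num_real // ler_sqr ?nnegrE // ler_norml lx ux.
have cube x : x ^+ 3 = x * x * x :> R by rewrite !exprS expr0 mulr1 mulrA.
set t := q11 + q22 + q33 in T0 eT.
(* Each diagonal entry is within [e] of [c], hence at least [t / 3 - 2 * e], and
   [1/3 - 2/16 = 5/24]. *)
have g1 : 5 / 24 * t <= q11 by rewrite /t in eT *; lra.
have g2 : 5 / 24 * t <= q22 by rewrite /t in eT *; lra.
have g3 : 5 / 24 * t <= q33 by rewrite /t in eT *; lra.
have t0 : 0 <= 5 / 24 * t by lra.
have P : (5 / 24 * t) ^+ 3 <= q11 * q22 * q33.
  by rewrite cube; apply: ler_pM => //; [exact: mulr_ge0|apply: ler_pM].
have e3 : e ^+ 3 <= (t / 16) ^+ 3 by rewrite lerXn2r ?nnegrE; lra.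
have e2 : e ^+ 2 <= (t / 16) ^+ 2 by rewrite lerXn2r ?nnegrE; lra.
have M : - (e ^+ 3) <= q12 * q13 * q23.
  have : `|q12 * q13 * q23| <= e ^+ 3.
    rewrite !normrM cube; apply: ler_pM; rewrite ?mulr_ge0 //.
      by apply: ler_pM; rewrite ?ler_norml ?l12 ?l13.
    by rewrite ler_norml l23.
  by rewrite ler_norml => /andP[].
have S : q11 * q23 ^+ 2 + q22 * q13 ^+ 2 + q33 * q12 ^+ 2 <= t * (t / 16) ^+ 2.
  move: ((t / 16) ^+ 2) e2 => w e2; rewrite /t !mulrDl.
  by rewrite !lerD ?ler_wpM2l ?(le_trans (sq _ _ _) e2) //; lra.
have t3 : 0 < t ^+ 3 by rewrite exprn_gt0.
(* In units of [t ^+ 3], [det0] contradicts [(5/24)^3 - 2/16^3 > 1/16^2]. *)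
move: P M S e3; rewrite !exprMn.
have -> : t * (t ^+ 2 * 16^-1 ^+ 2) = t ^+ 3 * 16^-1 ^+ 2 by ring.
rewrite !exprS !expr0; set t' := t ^+ 3.
lra.
Qed.

Definition modulus (R : rcfType) (x y : R) := Num.sqrt (x ^+ 2 + y ^+ 2).

Lemma modulus_ge0 (R : rcfType) (x y : R) : 0 <= modulus x y.
Proof. exact: sqrtr_ge0. Qed.

Lemma sqr_modulus (R : rcfType) (x y : R) : modulus x y ^+ 2 = x ^+ 2 + y ^+ 2.
Proof. by rewrite sqr_sqrtr // addr_ge0 ?sqr_ge0. Qed.

(* A quadratic form on R^3 is determined by its values at these points. *)
Definition test_points (R : rcfType) : seq (R * R * R) :=
  let h := (Num.sqrt 2)^-1 in
  [:: (1, 0, 0); (0, 1, 0); (0, 0, 1); (h, h, 0); (h, - h, 0);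
      (h, 0, h); (h, 0, - h); (0, h, h); (0, h, - h)].

Lemma test_points_unit (R : rcfType) (u : R * R * R) :
  u \in test_points R -> u.1.1 ^+ 2 + u.1.2 ^+ 2 + u.2 ^+ 2 = 1.
Proof.
have h2 : (Num.sqrt 2 : R)^-1 ^+ 2 = 2^-1 by rewrite exprVn sqr_sqrtr.
by rewrite !inE; do ![case/predU1P=> [-> /=|]] => [||||||||/eqP -> /=];
  rewrite ?sqrrN ?h2 //; lra.
Qed.

(** The modulus of a complex-valued real-linear form on 3-space, with real part [a] and imaginary
    part [b]. *)
Definition linear_modulus (R : rcfType) (a b u : R * R * R) : R :=
  modulus (u.1.1 * a.1.1 + u.1.2 * a.1.2 + u.2 * a.2)
          (u.1.1 * b.1.1 + u.1.2 * b.1.2 + u.2 * b.2).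

(* If all moduli were within [sqrt t / 40] of [r], with [t] the trace, all values
   of the squared form would be within [t / 16] of [r ^+ 2]. *)
Lemma linear_modulus_deviation (R : rcfType) (a b : R * R * R) (r : R) :
  (a.1.1 ^+ 2 + b.1.1 ^+ 2 + (a.1.2 ^+ 2 + b.1.2 ^+ 2) + (a.2 ^+ 2 + b.2 ^+ 2))
    / 1600 <= \sum_(u <- test_points R) (linear_modulus a b u - r) ^+ 2.
Proof.
set N := linear_modulus a b.
case: a b @N => [[a1 a2] a3] [[b1 b2] b3] N /=.
set t := (X in X / _); set S := \sum_(_ <- _) _.
rewrite leNgt; apply/negP => St.
have S0 : 0 <= S by apply: sumr_ge0 => u _; exact: sqr_ge0.
have t0 : 0 < t by lra.
set s := Num.sqrt t.
have s0 : 0 < s by rewrite sqrtr_gt0.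
have s2 : s ^+ 2 = t by rewrite sqr_sqrtr // ltW.
have dev u : u \in test_points R -> `|N u - r| <= s / 40.
  move=> uP; rewrite -ler_sqr ?nnegrE ?normr_ge0 //; last by lra.
  rewrite real_normK ?num_real // exprMn s2.
  have : (N u - r) ^+ 2 <= S.
    rewrite /S (big_rem u) //= lerDl sumr_ge0 // => ? _; apply: sqr_ge0.
  rewrite exprVn; lra.
have key u : u \in test_points R -> N u ^+ 2 <= t -> `|N u ^+ 2 - r ^+ 2| <= t / 16.
  move=> /dev d Nt.
  have Ns : N u <= s by rewrite -ler_sqr ?nnegrE ?modulus_ge0 ?s2 // ltW.
  have N0 : 0 <= N u by exact: modulus_ge0.
  rewrite subr_sqr normrM -s2.
  (* Here [N u <= s] and [r <= N u + s / 40]. The resulting factor [81/1600] is below [1/16]. *)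
  have d2 : `|N u + r| <= 81 / 40 * s.
    by move: d; rewrite !ler_norml => /andP[d1 d2]; apply/andP; split; lra.
  apply: (@le_trans _ _ (s / 40 * (81 / 40 * s))); first by rewrite ler_pM.
  have : 0 <= s ^+ 2 by rewrite sqr_ge0.
  rewrite expr2; set ss := s * s => ?.
  have -> : s / 40 * (81 / 40 * s) = ss * (81 / 1600) by rewrite /ss; field.
  lra.
have h2 : (Num.sqrt 2 : R)^-1 * (Num.sqrt 2)^-1 = 2^-1.
  by rewrite -expr2 exprVn sqr_sqrtr.
move: key; rewrite /N /linear_modulus /test_points; set h := _^-1 => key.
have {}key (u : R * R * R) q : u \in test_points R -> q <= t ->
    (u.1.1 * a1 + u.1.2 * a2 + u.2 * a3) ^+ 2 +
    (u.1.1 * b1 + u.1.2 * b2 + u.2 * b3) ^+ 2 = q ->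
    - (t / 16) <= q - r ^+ 2 <= t / 16.
  move=> uP qt uq; have := key u uP; rewrite sqr_modulus uq.
  by move=> /(_ qt); rewrite ler_norml.
have sq (x : R) : 0 <= x ^+ 2 := sqr_ge0 x.
have [[sa1 sa2] sa3] := (sq a1, sq a2, sq a3).
have [[sb1 sb2] sb3] := (sq b1, sq b2, sq b3).
have k1 : - (t / 16) <= a1 ^+ 2 + b1 ^+ 2 - r ^+ 2 <= t / 16.
  by apply: (key (1, 0, 0)); [rewrite !inE eqxx|rewrite /t; lra|move=> /=; ring].
have k2 : - (t / 16) <= a2 ^+ 2 + b2 ^+ 2 - r ^+ 2 <= t / 16.
  by apply: (key (0, 1, 0)); [rewrite !inE eqxx ?orbT|rewrite /t; lra|move=> /=; ring].
have k3 : - (t / 16) <= a3 ^+ 2 + b3 ^+ 2 - r ^+ 2 <= t / 16.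
  by apply: (key (0, 0, 1)); [rewrite !inE eqxx ?orbT|rewrite /t; lra|move=> /=; ring].
have half (u : R * R * R) x z : u \in test_points R ->
    u.1.1 * a1 + u.1.2 * a2 + u.2 * a3 = h * x ->
    u.1.1 * b1 + u.1.2 * b2 + u.2 * b3 = h * z -> x ^+ 2 + z ^+ 2 <= t * 2 ->
    - (t / 16) <= (x ^+ 2 + z ^+ 2) / 2 - r ^+ 2 <= t / 16.
  move=> uP ua ub le_t; apply: (key u) => //; first by lra.
  by rewrite ua ub !exprMn [h ^+ 2]expr2 h2; field.
(* Polarisation: the form takes the values (mean of two diagonal entries) plus or minus the
   off-diagonal entry at [u] and [v], so half their difference is that entry. *)
have cross (u v : R * R * R) x y z w :
    u \in test_points R -> v \in test_points R ->
    u.1.1 * a1 + u.1.2 * a2 + u.2 * a3 = h * (x + y) ->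
    v.1.1 * a1 + v.1.2 * a2 + v.2 * a3 = h * (x - y) ->
    u.1.1 * b1 + u.1.2 * b2 + u.2 * b3 = h * (z + w) ->
    v.1.1 * b1 + v.1.2 * b2 + v.2 * b3 = h * (z - w) ->
    x ^+ 2 + y ^+ 2 + z ^+ 2 + w ^+ 2 <= t -> `|x * y + z * w| <= t / 16.
  move=> uP vP ua va ub vb le_t.
  have [[[i1 i2] i3] i4] := (sq (x - y), sq (x + y), sq (z - w), sq (z + w)).
  rewrite !sqrrB !sqrrD in i1 i2 i3 i4.
  have := half v (x - y) (z - w) vP va vb; rewrite !sqrrB => /(_ ltac:(lra)).
  have := half u (x + y) (z + w) uP ua ub; rewrite !sqrrD => /(_ ltac:(lra)).
  by rewrite ler_norml => /andP[? ?] /andP[? ?]; apply/andP; split; lra.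
have k12 : `|a1 * a2 + b1 * b2| <= t / 16.
  apply: (cross (h, h, 0) (h, - h, 0)); rewrite ?inE ?eqxx ?orbT //=; try ring.
  by rewrite /t; lra.
have k13 : `|a1 * a3 + b1 * b3| <= t / 16.
  apply: (cross (h, 0, h) (h, 0, - h)); rewrite ?inE ?eqxx ?orbT //=; try ring.
  by rewrite /t; lra.
have k23 : `|a2 * a3 + b2 * b3| <= t / 16.
  apply: (cross (0, h, h) (0, h, - h)); rewrite ?inE ?eqxx ?orbT //=; try ring.
  by rewrite /t; lra.
apply: (@degenerate_form_not_scalar _ a1 a2 a3 b1 b2 b3 (r ^+ 2) (t / 16)) => //;
  rewrite ?ler_norml // -/t.
lra.
Qed.

(** * Distance to torus orbits and orthonormal frames *)

(** Reverse triangle inequality in the complex plane: a rotation preserves the modulus, and what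
    remains is Cauchy-Schwarz. *)
Lemma sqr_modulusB_rot (R : rcfType) (x y c s x' y' : R) :
  c ^+ 2 + s ^+ 2 = 1 ->
  (modulus x y - modulus x' y') ^+ 2 <=
  (x - (c * x' - s * y')) ^+ 2 + (y - (s * x' + c * y')) ^+ 2.
Proof.
move=> cs.
set X := c * x' - s * y'; set Y := s * x' + c * y'.
have -> : modulus x' y' = modulus X Y.
  rewrite /modulus; congr Num.sqrt.
  by rewrite -[LHS]mul1r -cs /X /Y; ring.
rewrite sqrrB !sqr_modulus !sqrrB.
suff : x * X + y * Y <= modulus x y * modulus X Y by lra.
apply: le_trans (ler_norm _) _.
rewrite -ler_sqr ?nnegrE ?mulr_ge0 ?modulus_ge0 // exprMn !sqr_modulus.
rewrite real_normK ?num_real //.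
(* Lagrange's identity: this square is the defect in Cauchy-Schwarz. *)
have := sqr_ge0 (x * Y - y * X); lra.
Qed.

Lemma sqr_enorm (R : realType) m (v : 'rV[R]_m) :
  enorm v ^+ 2 = \sum_(i < m) v 0 i ^+ 2.
Proof. by rewrite sqr_sqrtr // sumr_ge0 // => i _; apply: sqr_ge0. Qed.

Lemma enorm_ge0 (R : realType) m (v : 'rV[R]_m) : 0 <= enorm v.
Proof. exact: sqrtr_ge0. Qed.

Lemma mulmx_tr_enorm (R : realType) m (v : 'rV[R]_m) : v *m v^T = (enorm v ^+ 2)%:M.
Proof.
apply/rowP => j; rewrite ord1 !mxE eqxx sqr_enorm; apply: eq_bigr => i _.
by rewrite mxE expr2.
Qed.

Lemma enorm_eq0 (R : realType) m (v : 'rV[R]_m) : enorm v = 0 -> v = 0.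
Proof.
move=> v0; have /psumr_eq0P : \sum_i v 0 i ^+ 2 = 0 by rewrite -sqr_enorm v0 expr0n.
move=> /(_ (fun i _ => sqr_ge0 _)) vi; apply/rowP => i.
by apply/eqP; rewrite mxE -sqrf_eq0 vi.
Qed.

Lemma moduli_dist_torus (R : realType) n (c s : 'rV[R]_n)
    (y x : 'rV[R]_(n + n)) :
  torus_elt c s ->
  \sum_i (modulus (lsubmx y 0 i) (rsubmx y 0 i) -
          modulus (lsubmx x 0 i) (rsubmx x 0 i)) ^+ 2 <=
  enorm (y - torus_act c s x) ^+ 2.
Proof.
move=> cs; rewrite sqr_enorm big_split_ord /= -big_split /=.
apply: ler_sum => i _; rewrite /torus_act.
by rewrite !(row_mxEl, row_mxEr, mxE); exact: sqr_modulusB_rot.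
Qed.

Lemma exists_orthonormal_frame (R : realType) r m (L : 'M[R]_(r, m)) k :
  (k <= \rank L)%N ->
  exists2 E : 'M[R]_(k, m), (E <= L)%MS & E *m E^T = 1%:M.
Proof.
elim: k => [_|k IHk kL].
  by exists 0; [exact: sub0mx|apply/matrixP => -[]].
have [E EL EE] := IHk (ltnW kL).
(* Gram-Schmidt by dimension count: [L *m E^T] has rank at most [k], less than the rank of [L], so
   some nonzero vector of [L] is orthogonal to [E]. *)
have : (L :&: kermx E^T)%MS != 0.
  rewrite -mxrank_eq0 -lt0n -(ltn_add2l (\rank (L *m E^T))) addn0 mxrank_mul_ker.
  exact: leq_ltn_trans (rank_leq_col _) kL.
case/rowV0Pn => v; rewrite sub_capmx => /andP[vL /sub_kermxP vE] v0.
have nv : enorm v != 0 by apply: contraNneq v0 => /enorm_eq0 ->.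
have Ev : E *m v^T = 0 by rewrite -[RHS]trmx0 -vE trmx_mul trmxK.
rewrite -[k.+1]/(1 + k)%N; exists (col_mx ((enorm v)^-1 *: v) E).
  by rewrite col_mx_sub scalemx_sub.
rewrite tr_col_mx mul_col_row EE linearZ /= -!scalemxAl -!scalemxAr.
rewrite vE Ev !scaler0 scalerA mulmx_tr_enorm.
rewrite scale_scalar_mx -invfM -expr2 mulVf ?expf_neq0 //.
by rewrite -scalar_mx_block.
Qed.

Lemma enorm_isometry (R : realType) k m (E : 'M[R]_(k, m)) (v : 'rV[R]_k) :
  E *m E^T = 1%:M -> enorm (v *m E) = enorm v.
Proof.
move=> EE; apply/eqP; rewrite -(eqrXn2 (ltn0Sn 1)) ?enorm_ge0 //; apply/eqP.
have := mulmx_tr_enorm (v *m E); rewrite trmx_mul mulmxA -(mulmxA v) EE mulmx1.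
by rewrite mulmx_tr_enorm => /matrixP/(_ 0 0); rewrite !mxE eqxx.
Qed.

Lemma big_ord3 (V : nmodType) (F : 'I_3 -> V) :
  \sum_i F i = F 0 + F 1 + F 2%R.
Proof.
rewrite !big_ord_recl big_ord0 addr0 addrA.
by congr (F _ + F _ + F _); apply: val_inj.
Qed.

Definition row3 (R : rcfType) (u : R * R * R) : 'rV[R]_3 :=
  \row_(j < 3) nth 0 [:: u.1.1; u.1.2; u.2] j.

(* Summing [linear_modulus_deviation] over the coordinates of C^n leaves the
   total trace [3] of the restricted Euclidean form, against nine test points. *)
Lemma torus_orbit_far (R : realType) n (L : 'M[R]_(3, n + n)) x :
  \rank L = 3 ->
  ~ subset_of (unit_sphere_of L) (eps_nbhd 100^-1 (torus_orbit x)).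
Proof.
move=> rkL LT.
have [|E EL EE] := @exists_orthonormal_frame R 3 _ L 3; first by rewrite rkL.
(* [a i] and [b i] are the real and imaginary parts of the [i]-th complex coordinate, read in the
   frame [E]. *)
pose a i := (E 0 (lshift n i), E 1 (lshift n i), E 2%R (lshift n i)).
pose b i := (E 0 (rshift n i), E 1 (rshift n i), E 2%R (rshift n i)).
pose rad i := modulus (lsubmx x 0 i) (rsubmx x 0 i).
have near u : u \in test_points R ->
    \sum_i (linear_modulus (a i) (b i) u - rad i) ^+ 2 <= 10000^-1.
  move=> /test_points_unit u1.
  have /LT[_ [c [s [cs ->]]] d] : unit_sphere_of L (row3 u *m E).
    split; first by rewrite mulmx_sub.
    rewrite enorm_isometry // -[RHS]sqrtr1 -u1 /enorm big_ord3.
    by rewrite !mxE.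
  have := moduli_dist_torus (row3 u *m E) x cs.
  have le_d : enorm (row3 u *m E - torus_act c s x) ^+ 2 <= 100^-1 ^+ 2.
    by rewrite ler_sqr ?nnegrE ?enorm_ge0 ?invr_ge0 // ltW.
  have -> : 10000^-1 = 100^-1 ^+ 2 :> R by field.
  move=> /le_trans /(_ le_d); apply: le_trans; apply: ler_sum => i _.
  by rewrite /linear_modulus /a /b /rad /= !mxE !big_ord3 !mxE lexx.
have far : 3 / 1600 <=
    \sum_i \sum_(u <- test_points R) (linear_modulus (a i) (b i) u - rad i) ^+ 2.
  have -> : 3 = \sum_j \sum_l E j l ^+ 2 :> R.
    rewrite (eq_bigr (fun=> 1)) => [|j _]; first by rewrite big_ord3; ring.
    move/matrixP/(_ j j): EE; rewrite !mxE eqxx => EEj; rewrite -[RHS]EEj.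
    by apply: eq_bigr => l _; rewrite mxE expr2.
  rewrite exchange_big big_split_ord /= -big_split /= mulr_suml.
  apply: ler_sum => i _; apply: le_trans (linear_modulus_deviation _ _ _).
  rewrite !big_ord3 /=; lra.
(* Nine points contribute at most [9/10000], less than [3/1600]; this is what the radius [100^-1] is
   chosen for. *)
have : 3 / 1600 <= \sum_(u <- test_points R) 10000^-1 :> R.
  apply: le_trans far _; rewrite exchange_big /= big_seq [leRHS]big_seq.
  exact: ler_sum.
rewrite /test_points !big_cons big_nil; lra.
Qed.

(** * Abelian orthogonal actions inside the torus action *)

(** A commuting family is triangular in a common unitary basis; since the adjoints are triangular in
    the same basis, the entries on the other side of the diagonal vanish too. *)
Lemma unitary_codiagonalization (C : numClosedFieldType) n (As : seq 'M[C]_n) :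
  {in As &, forall A B, comm_mx A B} ->
  {in As, forall A, map_mx Num.conj A^T \in As} ->
  codiagonalizable_in (@unitarymx C n n) As.
Proof.
move=> /cotrigonalization[P Pu /allP Ptrig] AsJ; exists P => //.
have Punit := unitarymx_unit Pu.
apply/allP => A AAs; apply/similar_diagPp => // i j; case: ltngtP => // [lt_ij|lt_ji] _.
  by have /is_trig_mxP-> := Ptrig _ AAs.
have /is_trig_mxP/(_ j i lt_ji)/eqP := Ptrig _ (AsJ _ AAs).
rewrite !conjumx // invmx_unitary // -[P as X in X *m _]trmxCK.
by rewrite -!map_mxM -!trmx_mul mulmxA 2!mxE conjC_eq0 => /eqP.
Qed.

Lemma Re_mulmx_real (R : rcfType) p m n (A : 'M[R]_(p, m)) (Q : 'M[R[i]]_(m, n)) :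
  map_mx (@complex.Re R) (map_mx (real_complex R) A *m Q) = A *m map_mx (@complex.Re R) Q.
Proof.
apply/matrixP => i j; rewrite !mxE (big_morph (@complex.Re R) (id1 := 0) (op1 := +%R)).
- by apply: eq_bigr => l _; rewrite !mxE; case: (Q l j) => a b /=; ring.
- by move=> [? ?] [? ?].
- by [].
Qed.

Lemma Im_mulmx_real (R : rcfType) p m n (A : 'M[R]_(p, m)) (Q : 'M[R[i]]_(m, n)) :
  map_mx (@complex.Im R) (map_mx (real_complex R) A *m Q) = A *m map_mx (@complex.Im R) Q.
Proof.
apply/matrixP => i j; rewrite !mxE (big_morph (@complex.Im R) (id1 := 0) (op1 := +%R)).
- by apply: eq_bigr => l _; rewrite !mxE; case: (Q l j) => a b /=; ring.
- by move=> [? ?] [? ?].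
- by [].
Qed.

(** The product [M *m M^T] is the real part of [Q] times its adjoint. *)
Lemma unitary_realification (R : rcfType) m n (Q : 'M[R[i]]_(m, n)) :
  Q \is unitarymx ->
  let M := row_mx (map_mx (@complex.Re R) Q) (map_mx (@complex.Im R) Q) in M *m M^T = 1%:M.
Proof.
move=> /unitarymxP QQ M; rewrite /M tr_row_mx mul_row_col.
apply/matrixP => i k; move/matrixP/(_ i k)/(congr1 (@complex.Re R)): QQ.
rewrite !mxE => QQ; transitivity (complex.Re ((i == k)%:R : R[i])).
  rewrite -QQ -big_split (big_morph (@complex.Re R) (id1 := 0) (op1 := +%R)) //=.
    apply: eq_bigr => l _; rewrite !mxE.
    case: (Q i l) (Q k l) => a b [c d] /=; ring.
  by move=> [? ?] [? ?].
by case: (i == k).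
Qed.

(* Complexify, diagonalise [rG] in a unitary basis, and send a real vector to
   the real and imaginary parts of its coordinates in that basis. *)
Lemma abelian_rep_in_torus (R : realType) (gT : finGroupType) (G : {group gT}) m
    (rG : mx_representation R G m) :
  abelian G -> orthogonal_rep rG ->
  exists2 M : 'M[R]_(m, m + m), M *m M^T = 1%:M &
    forall g v, g \in G -> torus_orbit (v *m M) (v *m rG g *m M).
Proof.
move=> abG orthG; pose cG g := map_mx (real_complex R) (rG g).
have conj_real (A : 'M[R]_m) :
    map_mx Num.conj (map_mx (real_complex R) A)^T = map_mx (real_complex R) A^T.
  by apply/matrixP => i j; rewrite !mxE; apply/eqP; rewrite eq_complex /= oppr0 !eqxx.
have [||P Pu /allP Pdiag] := @unitary_codiagonalization R[i] m [seq cG g | g <- enum G].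
- move=> _ _ /mapP[g + ->] /mapP[h + ->]; rewrite !mem_enum => gG hG.
  by rewrite /comm_mx /cG -!map_mxM -!repr_mxM // (centsP abG _ gG _ hG).
(* The adjoint of a real orthogonal matrix is its inverse, here the image of [g^-1]. *)
- move=> _ /mapP[g + ->]; rewrite mem_enum => gG.
  apply/mapP; exists (g^-1)%g; first by rewrite mem_enum groupV.
  rewrite conj_real /cG repr_mxV //; congr map_mx.
  by rewrite -[LHS]mul1mx -(mulVmx (repr_mx_unit rG gG)) -mulmxA orthG ?mulmx1.
(* Vectors are rows, so the columns of [Q], the adjoint of [P], are the common eigenvectors. *)
pose Q := map_mx Num.conj P^T.
exists (row_mx (map_mx (@complex.Re R) Q) (map_mx (@complex.Im R) Q)).
  by apply: unitary_realification; rewrite trmxC_unitary.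
move=> g v gG.
have /similar_diagPex[D /eqP gD] : similar_diag P (cG g).
  by apply: Pdiag; apply: map_f; rewrite mem_enum.
rewrite /= conjymx // in gD.
(* Unitarity puts the eigenvalues on the unit circle, so [D] is a torus element. *)
have unitD : diag_mx D \is unitarymx.
  rewrite -gD !mul_unitarymx ?trmxC_unitary //; apply/unitarymxP.
  by rewrite conj_real -map_mxM orthG // map_mx1.
have gQ : cG g *m Q = Q *m diag_mx D.
  by rewrite -gD !mulmxA (mulmx1C (unitarymxP Pu)) mul1mx.
exists (map_mx (@complex.Re R) D), (map_mx (@complex.Im R) D); split.
  move=> i; move/unitarymxP/matrixP/(_ i i): unitD.
  rewrite tr_diag_mx map_diag_mx mulmx_diag !mxE eqxx => /(congr1 (@complex.Re R)).
  by case: (D 0 i) => c s /= <-; ring.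
have toC (A : 'rV[R]_m) : A *m row_mx (map_mx (@complex.Re R) Q) (map_mx (@complex.Im R) Q) =
    row_mx (map_mx (@complex.Re R) (map_mx (real_complex R) A *m Q))
           (map_mx (@complex.Im R) (map_mx (real_complex R) A *m Q)).
  by rewrite mul_mx_row Re_mulmx_real Im_mulmx_real.
rewrite !toC map_mxM -mulmxA -/(cG g) gQ mulmxA /torus_act row_mxKl row_mxKr.
rewrite mul_mx_diag; move: (_ *m Q) => w.
by congr row_mx; apply/rowP => j; rewrite !mxE; case: (w 0 j) (D 0 j) => a b [c d] /=; ring.
Qed.

(** * Transfer to finite abelian groups and conclusion *)

(** The isometry [M] sends the span of the first three coordinate vectors to a 3-dimensional space
    in ['rV_(m + m)]; as [3 <= k], its unit sphere would lie near a torus orbit. *)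
Lemma rep_orbit_far (R : realType) (gT : finGroupType) (G : {group gT}) m
    (rG : mx_representation R G m) (v : 'rV[R]_m) k :
  (3 <= k)%N -> (k <= m)%N -> abelian G -> orthogonal_rep rG ->
  ~ subset_of (@std_sphere R m k) (eps_nbhd 100^-1 (rep_orbit rG v)).
Proof.
move=> k3 km abG orthG near; have m3 := leq_trans k3 km.
have [M MM torM] := abelian_rep_in_torus abG orthG.
pose I3 : 'M[R]_(3, m) := pid_mx 3.
have II : I3 *m I3^T = 1%:M.
  by rewrite /I3 tr_pid_mx mul_pid_mx minnn (minn_idPr m3) pid_mx_1.
have LL : (I3 *m M) *m (I3 *m M)^T = 1%:M.
  by rewrite trmx_mul mulmxA -(mulmxA I3) MM mulmx1.
apply: (@torus_orbit_far R m (I3 *m M) (v *m M)).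
  apply/eqP; rewrite eqn_leq rank_leq_row /=.
  by have := mxrankM_maxl (I3 *m M) (I3 *m M)^T; rewrite LL mxrank1.
move=> _ [/submxP[D ->] D1].
have /near[_ [g gG ->] d] : std_sphere k (D *m I3).
  split; first by move: D1; rewrite mulmxA enorm_isometry.
  move=> i ki; rewrite mxE big1 // => j _; rewrite mxE.
  case: eqP => [ji|_]; rewrite ?mulr0 //.
  by have := leq_trans k3 ki; rewrite -ji leqNgt ltn_ord.
exists (v *m rG g *m M); first exact: torM.
by rewrite mulmxA -mulmxBl enorm_isometry.
Qed.

Theorem theorem3 (R : realType) :
  exists eps : R, 0 < eps /\
    (forall (n : nat) (L : 'M[R]_(3, n + n)) (x : 'rV[R]_(n + n)),
        (1 <= n)%N -> \rank L = 3%N ->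
        ~ subset_of (unit_sphere_of L) (eps_nbhd eps (torus_orbit x))) /\
    (forall (k : nat), (3 <= k)%N ->
       forall (p : nat) (gT : finGroupType) (G : {group gT}) (m : nat)
              (rG : mx_representation R G m) (v : 'rV[R]_m),
         prime p -> (p.-abelem G)%g -> (k <= m)%N -> orthogonal_rep rG ->
         enorm v = 1 ->
         ~ subset_of (@std_sphere R m k) (eps_nbhd eps (rep_orbit rG v))).
Proof.
exists 100^-1; split; first by rewrite invr_gt0.
split=> [n L x _|k k3 p gT G m rG v _ pG km orthG _]; first exact: torus_orbit_far.
exact: rep_orbit_far k3 km (abelem_abelian pG) orthG.
Qed.
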